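(* Let $\mathcal{A}$ be a Banach algebra and $\mathcal{I}$ be a closed ideal of $\mathcal{A}$. If $N(\mathcal{A}/\mathcal{I})$ and $N(\mathcal{I} \times_c \mathcal{I})$ are both singletons, then $N(\mathcal{A} \times_c \mathcal{I})$ is a singleton.
   Context: Algebras are associative algebras over $\mathbb{C}$ (not assumed unital or commutative); ideals are two-sided. An algebra norm on an algebra $\mathcal{A}$ is a vector space norm $\|\cdot\|$ on $\mathcal{A}$ that is submultiplicative, i.e. $\|ab\| \le \|a\|\|b\|$ for all $a,b \in \mathcal{A}$ (completeness is not required). A Banach algebra is an algebra with a complete algebra norm. $N(\mathcal{A})$ denotes the set of equivalence classes of all algebra norms on $\mathcal{A}$, where two norms are identified if they are equivalent (induce the same topology). For an algebra $\mathcal{A}$ and an ideal $\mathcal{I}$ of $\mathcal{A}$, the convolution product algebra $\mathcal{A} \times_c \mathcal{I}$ is the vector space $\mathcal{A} \times \mathcal{I}$ with coordinatewise linear operations and the product $(a,x) \times_c (b,y) = (ab + xy, ay + xb)$. The algebra $\mathcal{I} \times_c \mathcal{I}$ is $\mathcal{I} \times \mathcal{I}$ with the product given by the same formula. *)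

(* Defs.v *)
From HB Require Import structures.
From mathcomp Require Import all_boot all_order all_algebra.
From mathcomp Require Import complex.
From mathcomp Require Import all_classical all_reals all_analysis.

Set Implicit Arguments.
Unset Strict Implicit.
Unset Printing Implicit Defensive.

Import Order.TTheory GRing.Theory Num.Theory.
Import numFieldNormedType.Exports.

Local Open Scope classical_set_scope.
Local Open Scope ring_scope.

(* The ring structures of MathComp are all unital, so the product of an
   algebra is taken from semigroupType, whose notation lives in %g. *)
Notation "a ** b" := (a * b)%g (at level 40, left associativity) : ring_scope.

HB.mixin Record Lmodule_Semigroup_isNuAlgebra (K : pzRingType) A
    of GRing.Lmodule K A & Semigroup A := {
  nuMDl : forall a b c : A, (a + b) ** c = a ** c + b ** c;
  nuMDr : forall a b c : A, a ** (b + c) = a ** b + a ** c;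
  nuZAl : forall (k : K) (a b : A), (k *: a) ** b = k *: (a ** b);
  nuZAr : forall (k : K) (a b : A), a ** (k *: b) = k *: (a ** b)
}.

#[short(type="nuAlgType")]
HB.structure Definition NuAlgebra (K : pzRingType) :=
  {A of GRing.Lmodule K A & Semigroup A & Lmodule_Semigroup_isNuAlgebra K A}.

HB.mixin Record NuAlgebra_Normed_isSubmultiplicative (K : numFieldType) A
    of NuAlgebra K A & NormedModule K A := {
  ler_nuM : forall a b : A, `|a ** b| <= `|a| * `|b|
}.

#[short(type="banachAlgType")]
HB.structure Definition BanachAlgebra (K : numFieldType) :=
  {A of NuAlgebra K A & CompleteNormedModule K A &
        NuAlgebra_Normed_isSubmultiplicative K A}.

Section NuAlgebraTheory.
Variables (K : pzRingType) (A : nuAlgType K).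
Implicit Types a b c : A.

Lemma nuMNl a b : (- a) ** b = - (a ** b).
Proof. by rewrite -scaleN1r nuZAl scaleN1r. Qed.

Lemma nuMNr a b : a ** (- b) = - (a ** b).
Proof. by rewrite -scaleN1r nuZAr scaleN1r. Qed.

Lemma nuMBl a b c : (a - b) ** c = a ** c - b ** c.
Proof. by rewrite nuMDl nuMNl. Qed.

Lemma nuMBr a b c : a ** (b - c) = a ** b - a ** c.
Proof. by rewrite nuMDr nuMNr. Qed.

End NuAlgebraTheory.

HB.mixin Record isAbsorbing (K : pzRingType) (A : nuAlgType K)
    (I : A -> bool) := {
  ideal_absorbl : forall a x, x \in I -> a ** x \in I;
  ideal_absorbr : forall x a, x \in I -> x ** a \in I
}.

#[short(type="nuIdeal")]
HB.structure Definition NuIdeal (K : pzRingType) (A : nuAlgType K) :=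
  {I of GRing.AddClosed A I & GRing.isScaleClosed K A I & isAbsorbing K A I}.

Lemma nuIdeal_mulg_closed (K : pzRingType) (A : nuAlgType K) (I : nuIdeal A) :
  mulg_closed I.
Proof. by move=> x y _ Iy; apply: ideal_absorbl. Qed.

Fact nuIdeal_oppr_closed (K : pzRingType) (A : nuAlgType K) (I : nuIdeal A) :
  oppr_closed I.
Proof. by move=> x Ix; rewrite -scaleN1r rpredZ. Qed.

HB.instance Definition _ (K : pzRingType) (A : nuAlgType K) (I : nuIdeal A) :=
  GRing.isOppClosed.Build A (NuIdeal.sort I) (nuIdeal_oppr_closed (I := I)).

Section IdealAlgebra.
Variables (K : pzRingType) (A : nuAlgType K) (I : nuIdeal A).

Record ideal_alg := IdealAlg { ideal_val : A; _ : ideal_val \in I }.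

HB.instance Definition _ := [isSub for ideal_val].
HB.instance Definition _ := [Choice of ideal_alg by <:].
HB.instance Definition _ := [SubChoice_isSubLmodule of ideal_alg by <:].
HB.instance Definition _ :=
  SubChoice_isSubSemigroup.Build A _ ideal_alg (nuIdeal_mulg_closed (I := I)).

Let valMi (x y : ideal_alg) : val (x ** y) = val x ** val y.
Proof. exact: valM. Qed.

Fact ideal_alg_mulDl (x y z : ideal_alg) : (x + y) ** z = x ** z + y ** z.
Proof. by apply: val_inj; rewrite raddfD !valMi raddfD nuMDl. Qed.

Fact ideal_alg_mulDr (x y z : ideal_alg) : x ** (y + z) = x ** y + x ** z.
Proof. by apply: val_inj; rewrite raddfD !valMi raddfD nuMDr. Qed.

Fact ideal_alg_scaleAl k (x y : ideal_alg) : (k *: x) ** y = k *: (x ** y).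
Proof. by apply: val_inj; rewrite linearZ !valMi linearZ nuZAl. Qed.

Fact ideal_alg_scaleAr k (x y : ideal_alg) : x ** (k *: y) = k *: (x ** y).
Proof. by apply: val_inj; rewrite linearZ !valMi linearZ nuZAr. Qed.

HB.instance Definition _ := Lmodule_Semigroup_isNuAlgebra.Build K ideal_alg
  ideal_alg_mulDl ideal_alg_mulDr ideal_alg_scaleAl ideal_alg_scaleAr.

Definition ideal_mull (a : A) (x : ideal_alg) : ideal_alg :=
  IdealAlg (ideal_absorbl a (val x) (valP x)).

Definition ideal_mulr (x : ideal_alg) (a : A) : ideal_alg :=
  IdealAlg (ideal_absorbr (val x) a (valP x)).

End IdealAlgebra.

(* Quotient.quot provides the additive group of cosets. *)
Section QuotientAlgebra.
Variables (K : pzRingType) (A : nuAlgType K) (I : nuIdeal A).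

Definition quot_alg := Quotient.quot I.

HB.instance Definition _ := GRing.Zmodule.on quot_alg.
HB.instance Definition _ := EqQuotient.on quot_alg.

Definition quot_pi (a : A) : quot_alg := (\pi_quot_alg a)%qT.

Definition quot_scale (k : K) (p : quot_alg) : quot_alg :=
  quot_pi (k *: repr p).

Definition quot_mul (p q : quot_alg) : quot_alg := quot_pi (repr p ** repr q).

Lemma quot_piD a b : quot_pi (a + b) = quot_pi a + quot_pi b.
Proof. exact: (@Quotient.pi_add A I). Qed.

Lemma quot_pi_surj p : exists a, p = quot_pi a.
Proof. by exists (repr p); rewrite /quot_pi reprK. Qed.

Lemma quot_pi_eq a b : (quot_pi a = quot_pi b) <-> (a - b \in I).
Proof.
have -> : (a - b \in I) = (quot_pi a == quot_pi b).
  exact: (Quotient.idealrBE I).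
by split=> /eqP.
Qed.

Let repr_pi (a : A) : repr (quot_pi a) - a \in I.
Proof. by apply/quot_pi_eq; rewrite /quot_pi reprK. Qed.

Lemma quot_scaleE k (a : A) : quot_scale k (quot_pi a) = quot_pi (k *: a).
Proof. by apply/quot_pi_eq; rewrite -scalerBr; apply/rpredZ/repr_pi. Qed.

Lemma quot_mulE (a b : A) :
  quot_mul (quot_pi a) (quot_pi b) = quot_pi (a ** b).
Proof.
apply/quot_pi_eq; set a' := repr _; set b' := repr _.
have -> : a' ** b' - a ** b = (a' - a) ** b' + a ** (b' - b).
  by rewrite nuMBl nuMBr addrA subrK.
by apply: rpredD; [apply/ideal_absorbr/repr_pi | apply/ideal_absorbl/repr_pi].
Qed.

Fact quot_scalerA k l p :
  quot_scale k (quot_scale l p) = quot_scale (k * l) p.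
Proof. by have [a ->] := quot_pi_surj p; rewrite !quot_scaleE scalerA. Qed.

Fact quot_scale1r : left_id 1 quot_scale.
Proof. by move=> p; have [a ->] := quot_pi_surj p; rewrite quot_scaleE scale1r. Qed.

Fact quot_scalerDr : right_distributive quot_scale +%R.
Proof.
move=> k p q; have [a ->] := quot_pi_surj p; have [b ->] := quot_pi_surj q.
by rewrite -quot_piD !quot_scaleE -quot_piD scalerDr.
Qed.

Fact quot_scalerDl p : {morph quot_scale^~ p : k l / k + l}.
Proof.
move=> k l; have [a ->] := quot_pi_surj p.
by rewrite !quot_scaleE -quot_piD scalerDl.
Qed.

HB.instance Definition _ := GRing.Zmodule_isLmodule.Build K quot_alg
  quot_scalerA quot_scale1r quot_scalerDr quot_scalerDl.

Fact quot_mulA : associative quot_mul.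
Proof.
move=> p q r; have [a ->] := quot_pi_surj p; have [b ->] := quot_pi_surj q.
by have [c ->] := quot_pi_surj r; rewrite !quot_mulE mulgA.
Qed.

HB.instance Definition _ := isSemigroup.Build quot_alg quot_mulA.

Lemma quot_piZ k a : quot_pi (k *: a) = k *: quot_pi a.
Proof. by rewrite -quot_scaleE. Qed.

Lemma quot_piM a b : quot_pi (a ** b) = quot_pi a ** quot_pi b.
Proof. by rewrite -quot_mulE. Qed.

Fact quot_mulDl (p q r : quot_alg) : (p + q) ** r = p ** r + q ** r.
Proof.
have [a ->] := quot_pi_surj p; have [b ->] := quot_pi_surj q.
by have [c ->] := quot_pi_surj r; rewrite -quot_piD -!quot_piM nuMDl quot_piD.
Qed.

Fact quot_mulDr (p q r : quot_alg) : p ** (q + r) = p ** q + p ** r.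
Proof.
have [a ->] := quot_pi_surj p; have [b ->] := quot_pi_surj q.
by have [c ->] := quot_pi_surj r; rewrite -quot_piD -!quot_piM nuMDr quot_piD.
Qed.

Fact quot_scaleAl k (p q : quot_alg) : (k *: p) ** q = k *: (p ** q).
Proof.
have [a ->] := quot_pi_surj p; have [b ->] := quot_pi_surj q.
by rewrite -quot_piZ -!quot_piM nuZAl quot_piZ.
Qed.

Fact quot_scaleAr k (p q : quot_alg) : p ** (k *: q) = k *: (p ** q).
Proof.
have [a ->] := quot_pi_surj p; have [b ->] := quot_pi_surj q.
by rewrite -quot_piZ -!quot_piM nuZAr quot_piZ.
Qed.

HB.instance Definition _ := Lmodule_Semigroup_isNuAlgebra.Build K quot_alg
  quot_mulDl quot_mulDr quot_scaleAl quot_scaleAr.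

End QuotientAlgebra.

Section ConvolutionProduct.
Variables (K : pzRingType) (A : nuAlgType K) (I : nuIdeal A).

Definition conv_alg : Type := (A * ideal_alg I)%type.

HB.instance Definition _ := GRing.Lmodule.on conv_alg.

Definition conv_mul (p q : conv_alg) : conv_alg :=
  (p.1 ** q.1 + ideal_val p.2 ** ideal_val q.2, ideal_mull p.1 q.2 + ideal_mulr p.2 q.1).

Let conv_inj (p q : conv_alg) : p.1 = q.1 -> ideal_val p.2 = ideal_val q.2 -> p = q.
Proof. by case: p q => [a x] [b y] /= -> /val_inj ->. Qed.

Fact conv_mulA : associative conv_mul.
Proof.
move=> p q r; apply: conv_inj; rewrite /= !nuMDl !nuMDr !mulgA.
  by rewrite [RHS]addrACA; congr (_ + _); rewrite addrC.
by rewrite [RHS]addrACA; congr (_ + _); rewrite addrC.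
Qed.

HB.instance Definition _ := isSemigroup.Build conv_alg conv_mulA.

Fact conv_mulDl (p q r : conv_alg) : (p + q) ** r = p ** r + q ** r.
Proof. by apply: conv_inj; rewrite /= !nuMDl addrACA. Qed.

Fact conv_mulDr (p q r : conv_alg) : p ** (q + r) = p ** q + p ** r.
Proof. by apply: conv_inj; rewrite /= !nuMDr addrACA. Qed.

Fact conv_scaleAl k (p q : conv_alg) : (k *: p) ** q = k *: (p ** q).
Proof. by apply: conv_inj; rewrite /= !nuZAl scalerDr. Qed.

Fact conv_scaleAr k (p q : conv_alg) : p ** (k *: q) = k *: (p ** q).
Proof. by apply: conv_inj; rewrite /= !nuZAr scalerDr. Qed.

HB.instance Definition _ := Lmodule_Semigroup_isNuAlgebra.Build K conv_alg
  conv_mulDl conv_mulDr conv_scaleAl conv_scaleAr.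

End ConvolutionProduct.

(* For B = ideal_alg I this is the algebra I x_c I. *)
Section ConvolutionSquare.
Variables (K : pzRingType) (B : nuAlgType K).

Definition conv_sqr : Type := (B * B)%type.

HB.instance Definition _ := GRing.Lmodule.on conv_sqr.

Definition conv_sqr_mul (p q : conv_sqr) : conv_sqr :=
  (p.1 ** q.1 + p.2 ** q.2, p.1 ** q.2 + p.2 ** q.1).

Let conv_sqr_inj (p q : conv_sqr) : p.1 = q.1 -> p.2 = q.2 -> p = q.
Proof. by case: p q => [a x] [b y] /= -> ->. Qed.

Fact conv_sqr_mulA : associative conv_sqr_mul.
Proof.
move=> p q r; apply: conv_sqr_inj; rewrite /= !nuMDl !nuMDr !mulgA.
  by rewrite [RHS]addrACA; congr (_ + _); rewrite addrC.
by rewrite [RHS]addrACA; congr (_ + _); rewrite addrC.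
Qed.

HB.instance Definition _ := isSemigroup.Build conv_sqr conv_sqr_mulA.

Fact conv_sqr_mulDl (p q r : conv_sqr) : (p + q) ** r = p ** r + q ** r.
Proof. by apply: conv_sqr_inj; rewrite /= !nuMDl addrACA. Qed.

Fact conv_sqr_mulDr (p q r : conv_sqr) : p ** (q + r) = p ** q + p ** r.
Proof. by apply: conv_sqr_inj; rewrite /= !nuMDr addrACA. Qed.

Fact conv_sqr_scaleAl k (p q : conv_sqr) : (k *: p) ** q = k *: (p ** q).
Proof. by apply: conv_sqr_inj; rewrite /= !nuZAl scalerDr. Qed.

Fact conv_sqr_scaleAr k (p q : conv_sqr) : p ** (k *: q) = k *: (p ** q).
Proof. by apply: conv_sqr_inj; rewrite /= !nuZAr scalerDr. Qed.

HB.instance Definition _ := Lmodule_Semigroup_isNuAlgebra.Build K conv_sqr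
  conv_sqr_mulDl conv_sqr_mulDr conv_sqr_scaleAl conv_sqr_scaleAr.

End ConvolutionSquare.

Section AlgebraNorms.
Variables (K : numFieldType) (A : nuAlgType K).
Implicit Types n m : A -> K.

(* As in normedModType K, norms take values in K; nonnegativity follows from
   the axioms (algebra_norm_ge0), so for K = R[i] the values are real. *)
Record algebra_norm n : Prop := AlgebraNorm {
  algebra_normD : forall a b, n (a + b) <= n a + n b;
  algebra_normZ : forall (k : K) a, n (k *: a) = `|k| * n a;
  algebra_norm0_eq0 : forall a, n a = 0 -> a = 0;
  algebra_normM : forall a b, n (a ** b) <= n a * n b
}.

Lemma algebra_norm_ge0 n a : algebra_norm n -> 0 <= n a.
Proof.
case=> nD nZ _ _; have := nD a (- a).
rewrite subrr -(scale0r a) nZ normr0 mul0r -(scaleN1r a) nZ normrN1 mul1r.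
by rewrite -mulr2n pmulrn_lge0.
Qed.

Definition norm_open n : set (set A) :=
  [set U | forall a, U a -> exists2 e, 0 < e & ball_ n a e `<=` U].

Definition norm_equiv n m : Prop := norm_open n = norm_open m.

Definition norm_class n : set (A -> K) :=
  [set m | algebra_norm m /\ norm_equiv n m].

Definition norm_classes : set (set (A -> K)) :=
  [set norm_class n | n in algebra_norm].

End AlgebraNorms.
Arguments norm_classes {K} A.

Definition is_singleton (T : Type) (S : set T) : Prop :=
  exists x, S = [set x].

(* Main.v *)
(* Let J = I x_c I, an ideal of B = A x_c I with B / J isomorphic to A / I, and
   let s be the norm |a| + |x| on B. For an arbitrary algebra norm n on B, the
   sum p = n + s is again an algebra norm. All algebra norms agree on J up to
   equivalence, so J is complete, hence closed, for each of them, and n, s, p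
   induce algebra norms on B / J, which are again equivalent by hypothesis.
   Equivalence on J and on B / J does not in general give equivalence on B, but
   it does for comparable norms: if n <= p, lift a class with its almost
   p-minimal representative c; then p c is bounded by a multiple of n b, and
   p (b - c) by a multiple of n (b - c) <= n b + p c. Applied to n <= p and to
   s <= p this makes both n and s equivalent to p. *)

Require Import Defs.
From mathcomp Require Import all_boot all_order all_algebra complex.
From mathcomp Require Import all_classical all_reals all_analysis.
From mathcomp Require Import ring.
Import Order.TTheory GRing.Theory Num.Theory.
Import numFieldNormedType.Exports.
Local Open Scope classical_set_scope.
Local Open Scope ring_scope.
Local Open Scope complex_scope.

Set Implicit Arguments.
Unset Strict Implicit.
Unset Printing Implicit Defensive.

(** * Algebra norms: equivalence as mutual domination up to constants *)

Section AlgebraNormTheory.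
Variables (K : numFieldType) (A : nuAlgType K).
Implicit Types n m : A -> K.

Lemma algebra_norm0 n : algebra_norm n -> n 0 = 0.
Proof. by move=> Nn; rewrite -(scale0r 0) (algebra_normZ Nn) normr0 mul0r. Qed.

Lemma algebra_normN n a : algebra_norm n -> n (- a) = n a.
Proof. by move=> Nn; rewrite -scaleN1r (algebra_normZ Nn) normrN1 mul1r. Qed.

Lemma algebra_normB n a b : algebra_norm n -> n (a - b) <= n a + n b.
Proof. by move=> Nn; rewrite -(algebra_normN b Nn) (algebra_normD Nn). Qed.

Lemma algebra_norm_gt0 n a : algebra_norm n -> a <> 0 -> 0 < n a.
Proof.
move=> Nn a0; rewrite lt_neqAle (algebra_norm_ge0 a Nn) andbT eq_sym.
by apply/eqP => /(algebra_norm0_eq0 Nn).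
Qed.

Lemma algebra_norm_add n m :
  algebra_norm n -> algebra_norm m -> algebra_norm (fun a => n a + m a).
Proof.
move=> Nn Nm; have n0 := fun a => algebra_norm_ge0 a Nn.
have m0 := fun a => algebra_norm_ge0 a Nm; split=> [a b|k a|a|a b].
- by rewrite addrACA lerD ?(algebra_normD Nn) ?(algebra_normD Nm).
- by rewrite (algebra_normZ Nn) (algebra_normZ Nm) mulrDr.
- move=> /eqP; rewrite paddr_eq0// => /andP[/eqP na _].
  exact: (algebra_norm0_eq0 Nn).
- apply: (le_trans (lerD (algebra_normM Nn a b) (algebra_normM Nm a b))).
  by rewrite mulrDl !mulrDr lerD// ?lerDl ?lerDr mulr_ge0.
Qed.

Lemma norm_open_ball1 n : algebra_norm n -> norm_open n (ball_ n 0 1).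
Proof.
move=> Nn a /=; rewrite sub0r (algebra_normN _ Nn) => na1.
exists (1 - n a); first by rewrite subr_gt0.
move=> b /=; rewrite sub0r (algebra_normN _ Nn) ltrBrDr => nab.
apply: le_lt_trans nab.
by rewrite -[in leLHS](subKr a b) [leRHS]addrC (algebra_normB _ _ Nn).
Qed.

(** The unit ball of [n] is open for [m], so it contains an [m]-ball about 0; homogeneity turns this
    into a global bound. *)
Lemma norm_equiv_le n m : algebra_norm n -> algebra_norm m ->
  norm_equiv n m -> exists2 C, 0 < C & forall a, n a <= C * m a.
Proof.
move=> Nn Nm nm; have := norm_open_ball1 Nn; rewrite nm.
have n00 : ball_ n 0 1 0 by rewrite /= subr0 algebra_norm0.
move=> /(_ 0 n00)[e e0 sub]; exists (2 / e); first by rewrite divr_gt0.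
move=> a; have [->|/eqP a0] := eqVneq a 0.
  by rewrite !algebra_norm0// mulr0.
have ma0 := algebra_norm_gt0 Nm a0.
(* This factor scales [a] to [m]-norm [e / 2], strictly inside the ball. *)
have k0 : 0 < e / (2 * m a) by rewrite divr_gt0// mulr_gt0.
have /sub : ball_ m 0 e ((e / (2 * m a)) *: a).
  rewrite /= sub0r (algebra_normN _ Nm) (algebra_normZ Nm) gtr0_norm//.
  rewrite invfM mulrA divfK ?gt_eqF// ltr_pdivrMr//.
  by rewrite ltr_pMr// ltr1n.
rewrite /= sub0r (algebra_normN _ Nn) (algebra_normZ Nn) gtr0_norm// => /ltW.
by rewrite -ler_pdivlMl// mulr1 invf_div mulrAC.
Qed.

Lemma le_norm_open n m C : 0 < C -> (forall a, n a <= C * m a) ->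
  norm_open n `<=` norm_open m.
Proof.
move=> C0 nm U oU a /oU[e e0 eU]; exists (e / C); first by rewrite divr_gt0.
move=> b /= mab; apply: eU => /=; apply: le_lt_trans (nm _) _.
by rewrite mulrC -ltr_pdivlMr.
Qed.

(** The form in which both singleton hypotheses are used. *)
Lemma singleton_le n m : is_singleton (norm_classes A) ->
  algebra_norm n -> algebra_norm m ->
  exists2 C, 0 < C & forall a, n a <= C * m a.
Proof.
move=> [x sx] Nn Nm.
have nx : norm_classes A (norm_class n) by exists n.
have mx : norm_classes A (norm_class m) by exists m.
move: nx mx; rewrite sx /= => <- mn.
have [_] : norm_class n m by rewrite -mn; split.
exact: norm_equiv_le.
Qed.

Lemma is_singleton_norm_classes s : algebra_norm s ->
  (forall n, algebra_norm n -> norm_equiv s n) ->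
  is_singleton (norm_classes A).
Proof.
move=> Ns sn; exists (norm_class s); apply/seteqP; split=> [_ [n Nn <-]|_ ->].
  have E := sn _ Nn; apply/seteqP.
  by split=> m [Nm mE]; split=> //; rewrite /norm_equiv -mE E.
by exists s.
Qed.

End AlgebraNormTheory.

Record alg_hom (K : pzRingType) (A B : nuAlgType K) (f : A -> B) : Prop :=
  AlgHom {
    alg_homD : forall a b, f (a + b) = f a + f b;
    alg_homZ : forall (k : K) a, f (k *: a) = k *: f a;
    alg_homM : forall a b, f (a ** b) = f a ** f b }.

Lemma algebra_norm_comp (K : numFieldType) (J B : nuAlgType K) (g : J -> B) n :
  alg_hom g -> injective g -> algebra_norm n -> algebra_norm (n \o g).
Proof.
move=> gH gI Nn; split=> [a b|k a|a|a b] /=.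
- by rewrite (alg_homD gH) (algebra_normD Nn).
- by rewrite (alg_homZ gH) (algebra_normZ Nn).
- move/(algebra_norm0_eq0 Nn) => ga; apply: gI; rewrite ga.
  by rewrite -[in RHS](scale0r (0 : J)) (alg_homZ gH) scale0r.
- by rewrite (alg_homM gH) (algebra_normM Nn).
Qed.

(* For linear f: the n-distance from b to the kernel of f is the infimum of n
   over the fibre of f b, so this says that the kernel is closed for n. *)
Definition ker_closed (K : numFieldType) (B Q : nuAlgType K) (f : B -> Q)
    (n : B -> K) :=
  forall b, (forall e, 0 < e -> exists2 c, f c = f b & n c < e) -> f b = 0.

(** * Quotient norms along a surjective homomorphism *)

Section QuotientNorm.
Variables (R : realType) (B Q : nuAlgType R[i]) (f : B -> Q).
Hypotheses (fH : alg_hom f) (f_surj : forall u, exists c, f c = u).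
Implicit Types n p : B -> R[i].

(** Infima exist in [R] only, hence the real part; it loses nothing, as algebra norms are
    real-valued. *)
Definition quot_norm n (u : Q) : R[i] :=
  (inf [set complex.Re (n c) | c in f @^-1` [set u]])%:C.

Lemma algebra_norm_Re n b : algebra_norm n -> n b = (complex.Re (n b))%:C.
Proof.
by move=> Nn; rewrite RRe_real// ger0_real// algebra_norm_ge0.
Qed.

Lemma algebra_norm_Re_ge0 n b : algebra_norm n -> 0 <= complex.Re (n b).
Proof.
by move=> Nn; rewrite -lecR -algebra_norm_Re// algebra_norm_ge0.
Qed.

Lemma quot_norm_le n c : algebra_norm n -> quot_norm n (f c) <= n c.
Proof.
move=> Nn; rewrite (algebra_norm_Re c Nn) lecR; apply: ge_inf; last by exists c.
by exists 0 => _ [d _ <-]; exact: algebra_norm_Re_ge0.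
Qed.

Lemma quot_norm_lt n u e : algebra_norm n -> quot_norm n u < e ->
  exists2 c, f c = u & n c < e.
Proof.
move=> Nn; have [c0 fc0] := f_surj u.
(* The order of [R[i]] compares only elements with equal imaginary parts, so [e] is real. *)
rewrite ltcE /= => /andP[/eqP Ie].
move=> /inf_lt[|_ [c fc <-] ce]; first by exists (complex.Re (n c0)), c0.
by exists c => //; rewrite (algebra_norm_Re c Nn) ltcE /= Ie eqxx.
Qed.

(* To bound something by an affine function of an infimum, bound it by that
   affine function at every competitor. *)
Lemma quot_norm_affine n u (z l k : R[i]) : algebra_norm n ->
  l \is Num.real -> 0 <= k ->
  (forall c, f c = u -> z <= l + k * n c) -> z <= l + k * quot_norm n u.
Proof.
move=> Nn lr; rewrite le_eqVlt => /predU1P[<-|k0].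
  by have [c fc] := f_surj u => /(_ c fc); rewrite !mul0r.
move=> zle.
have zr : z \is Num.real.
  have [c fc] := f_surj u; rewrite (ler_real (zle c fc)).
  by rewrite realD// realM ?(gtr0_real k0)// ger0_real ?algebra_norm_ge0.
rewrite -lerBlDl mulrC -ler_pdivrMr//.
have wr : (z - l) / k \is Num.real.
  by rewrite realM ?realB// realV gtr0_real.
rewrite -(RRe_real wr) lecR; apply: lb_le_inf.
  by have [c fc] := f_surj u; exists (complex.Re (n c)), c.
move=> _ [c fc <-]; rewrite -lecR -algebra_norm_Re// RRe_real//.
by rewrite ler_pdivrMr// lerBlDl mulrC zle.
Qed.

Lemma quot_norm_ge0 n u : algebra_norm n -> 0 <= quot_norm n u.
Proof.
move=> Nn; rewrite -[leRHS]mul1r -[leRHS]add0r.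
apply: quot_norm_affine => // c _.
by rewrite mul1r add0r algebra_norm_ge0.
Qed.

Lemma quot_norm_algebra_norm n : algebra_norm n -> ker_closed f n ->
  algebra_norm (quot_norm n).
Proof.
move=> Nn fcl; have q0 := fun u => quot_norm_ge0 u Nn.
have n0 := fun a => algebra_norm_ge0 a Nn.
have qZ k u : quot_norm n (k *: u) <= `|k| * quot_norm n u.
  rewrite -[leRHS]add0r; apply: quot_norm_affine => // c <-; rewrite add0r.
  by rewrite -(algebra_normZ Nn) -(alg_homZ fH) quot_norm_le.
split=> [u v|k u|u|u v].
(* The two infima are replaced by competitors one at a time. *)
- rewrite -[X in _ <= _ + X]mul1r; apply: quot_norm_affine => //.
    exact: ger0_real.
  move=> d fd; rewrite mul1r [leRHS]addrC -[X in _ <= _ + X]mul1r.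
  apply: quot_norm_affine => //; first exact: ger0_real.
  move=> c fc; rewrite mul1r [leRHS]addrC -fc -fd -(alg_homD fH).
  exact: le_trans (quot_norm_le _ Nn) (algebra_normD Nn _ _).
(* The reverse inequality is [qZ] for the inverse scalar. *)
- apply/eqP; rewrite eq_le qZ /=; have [->|k0] := eqVneq k 0.
    by rewrite normr0 mul0r q0.
  rewrite -ler_pdivlMl ?normr_gt0// -normfV; apply: le_trans (qZ _ _).
  by rewrite scalerA mulVf// scale1r.
- move=> qu; have [b fb] := f_surj u; rewrite -fb; apply: fcl => e e0.
  by apply: quot_norm_lt; rewrite // fb qu.
- rewrite -[leRHS]add0r; apply: quot_norm_affine => // d fd.
  rewrite add0r mulrC -[leRHS]add0r; apply: quot_norm_affine => // c fc.
  rewrite add0r mulrC -fc -fd -(alg_homM fH).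
  exact: le_trans (quot_norm_le _ Nn) (algebra_normM Nn _ _).
Qed.

End QuotientNorm.

(** * Comparable norms on an extension of [Q] by [J] *)

Section Extension.
Variables (R : realType) (J B Q : nuAlgType R[i]) (g : J -> B) (f : B -> Q).
Hypotheses (gH : alg_hom g) (g_inj : injective g).
Hypotheses (fH : alg_hom f) (f_surj : forall u, exists c, f c = u).
Hypothesis fg : forall b c, f b = f c -> exists j, b - c = g j.
Hypotheses (J1 : is_singleton (norm_classes J)).
Hypotheses (Q1 : is_singleton (norm_classes Q)).
Implicit Types n p : B -> R[i].

Lemma extension_le n p : algebra_norm n -> algebra_norm p ->
  (forall b, n b <= p b) -> ker_closed f n ->
  exists2 C, 0 < C & forall b, p b <= C * n b.
Proof.
move=> Nn Np np ncl.
have pcl : ker_closed f p.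
  move=> b H; apply: ncl => e /H[c fc pc]; exists c => //.
  exact: le_lt_trans (np c) pc.
have [C C0 Cle] := singleton_le Q1
  (quot_norm_algebra_norm fH f_surj Np pcl)
  (quot_norm_algebra_norm fH f_surj Nn ncl).
have [D D0 Dle] := singleton_le J1 (algebra_norm_comp gH g_inj Np)
  (algebra_norm_comp gH g_inj Nn).
(* [C + 1] bounds the lift [c], and the other summand bounds [b - c], which lies in the image of
   [J]. *)
exists (C + 1 + D * (1 + (C + 1))).
  by rewrite !addr_gt0 ?mulr_gt0 ?addr_gt0.
move=> b; have [->|/eqP b0] := eqVneq b 0.
  by rewrite !algebra_norm0// mulr0.
have nb0 := algebra_norm_gt0 Nn b0.
(* Since [n b] is positive, [C + 1] in place of [C] makes the inequality strict, so some lift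
   attains it. *)
have [||c fc pc] := @quot_norm_lt _ _ _ f f_surj p (f b) ((C + 1) * n b) => //.
  apply: le_lt_trans (Cle _) _; apply: le_lt_trans (_ : C * n b < _).
    by rewrite ler_pM2l// quot_norm_le.
  by rewrite mulrDl mul1r ltrDl.
have [j bcj] := fg (esym fc).
have nj : n (g j) <= (1 + (C + 1)) * n b.
  rewrite -bcj (le_trans (algebra_normB _ _ Nn))// [leRHS]mulrDl mul1r lerD2l.
  exact: le_trans (np c) (ltW pc).
have -> : b = c + g j by rewrite -bcj addrC subrK.
rewrite (le_trans (algebra_normD Np _ _))//.
have -> : c + g j = b by rewrite -bcj addrC subrK.
rewrite mulrDl lerD ?(ltW pc)// -mulrA.
by apply: le_trans (Dle j) _; rewrite ler_pM2l.
Qed.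

End Extension.

(** * The convolution product as an extension of the quotient by the convolution square *)

Section ConvolutionNorms.
Variables (R : realType) (A : banachAlgType R[i]) (I : nuIdeal A).
Let B := conv_alg I.
Let J := conv_sqr (ideal_alg I).

Definition conv_norm (p : conv_alg I) : R[i] := `|p.1| + `|ideal_val p.2|.

Definition conv_sqr_inc (j : conv_sqr (ideal_alg I)) : conv_alg I :=
  (ideal_val j.1, j.2).

Definition conv_quot (b : conv_alg I) : quot_alg I := quot_pi I b.1.

Lemma conv_norm_algebra_norm : algebra_norm conv_norm.
Proof.
split=> [[a x] [b y]|k [a x]|[a x]|[a x] [b y]]; rewrite /conv_norm /=.
- by rewrite addrACA lerD ?ler_normD.
- by rewrite !normrZ mulrDr.
- move/eqP; rewrite paddr_eq0// !normr_eq0 => /andP[/eqP -> /eqP x0].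
  by congr pair; apply: val_inj.
- apply: (le_trans (lerD (ler_normD _ _) (ler_normD _ _))).
  apply: (le_trans (lerD (lerD (ler_nuM _ _) (ler_nuM _ _))
    (lerD (ler_nuM _ _) (ler_nuM _ _)))).
  by rewrite le_eqVlt; apply/orP; left; apply/eqP; ring.
Qed.

Lemma conv_sqr_inc_hom : alg_hom conv_sqr_inc.
Proof.
split=> // a b; congr pair; congr (_ + _); apply: val_inj.
  exact: (valM (a.1 : ideal_alg I)).
exact: (valM (a.2 : ideal_alg I)).
Qed.

Lemma conv_sqr_inc_inj : injective conv_sqr_inc.
Proof. by move=> [x y] [x' y'] [/val_inj -> ->]. Qed.

Lemma conv_quot_surj u : exists b, conv_quot b = u.
Proof. by have [a ->] := quot_pi_surj u; exists (a, 0). Qed.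

Lemma conv_quot_eq b c :
  conv_quot b = conv_quot c -> exists j, b - c = conv_sqr_inc j.
Proof.
by move=> /quot_pi_eq bc; exists (IdealAlg bc, b.2 - c.2).
Qed.

(** The first coordinate is multiplicative only modulo [I]: the extra term is a product of two
    elements of [I]. *)
Lemma conv_quot_hom : alg_hom conv_quot.
Proof.
split=> [a b|k a|a b]; rewrite /conv_quot /=.
- exact: quot_piD.
- exact: quot_piZ.
- rewrite -quot_piM; apply/quot_pi_eq.
  by rewrite addrC addKr; apply/ideal_absorbl/valP.
Qed.

Lemma conv_quot_inc j : conv_quot (conv_sqr_inc j) = 0.
Proof.
have -> : conv_quot (conv_sqr_inc j) = conv_quot 0.
  by apply/quot_pi_eq; rewrite subr0; apply: (valP (j.1 : ideal_alg I)).
by rewrite -[in LHS](scale0r (0 : B)) (alg_homZ conv_quot_hom) scale0r.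
Qed.

(* By uniqueness of the norm on I x_c I, which is complete for conv_norm, it is
   complete for every algebra norm n, hence closed. *)
Lemma conv_quot_ker_closed n : closed [set a : A | a \in I] ->
  is_singleton (norm_classes J) -> algebra_norm n -> ker_closed conv_quot n.
Proof.
move=> Icl J1 Nn b H.
have Ns := conv_norm_algebra_norm.
have [C C0 Cle] := singleton_le J1
  (algebra_norm_comp conv_sqr_inc_hom conv_sqr_inc_inj Nn)
  (algebra_norm_comp conv_sqr_inc_hom conv_sqr_inc_inj Ns).
have [D D0 Dle] := singleton_le J1
  (algebra_norm_comp conv_sqr_inc_hom conv_sqr_inc_inj Ns)
  (algebra_norm_comp conv_sqr_inc_hom conv_sqr_inc_inj Nn).
pose S (e : R[i]) := [set j : J | n (b - conv_sqr_inc j) < e].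
pose F := filter_from [set e : R[i] | 0 < e] S.
have S0 e : 0 < e -> exists j, S e j.
  move=> /H[c /esym/conv_quot_eq[j bcj] nc]; exists j.
  by rewrite /S /= -bcj subKr.
have FF : ProperFilter F.
  apply: filter_from_proper => //; apply: filter_from_filter.
    by exists 1; rewrite /= ltr01.
  move=> e e' /= e0 e'0.
  have [ee|/ltW ee] := real_leP (gtr0_real e0) (gtr0_real e'0).
  - by exists e => // j je; split=> //; exact: lt_le_trans ee.
  - by exists e' => // j je; split=> //; exact: lt_le_trans ee.
(* Applied below to the two coordinates, which are 1-Lipschitz for [conv_norm]. *)
have limI (v : J -> A) : (forall j, v j \in I) ->
    (forall j k, `|v j - v k| <= conv_norm (conv_sqr_inc (j - k))) ->
    exists x : ideal_alg I, v @ F --> val x.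
  move=> vI vlip.
  have : cvg (v @ F).
    apply: cauchy_cvg; apply: cauchy_exP => e e0.
    (* Two members of this [S] differ by less than [e / D] in [n], hence by less than [e] in
       [conv_norm]. *)
    have e'0 : 0 < e / D / 2 by rewrite !divr_gt0.
    have [k kS] := S0 _ e'0.
    exists (v k), (e / D / 2) => // j jS; rewrite -ball_normE /ball_ /=.
    apply: le_lt_trans (vlip k j) _; apply: le_lt_trans (Dle _) _.
    rewrite mulrC -ltr_pdivlMr//= [e / D]splitr.
    apply: le_lt_trans (ltrD jS kS).
    apply: le_trans (algebra_normB _ _ Nn).
    by rewrite opprB [X in _ <= n X]addrC addrA subrK.
  move=> vcvg; have vlimI : lim (v @ F) \in I.
    by apply: (closed_cvg _ Icl) vcvg; exact: nearW.
  by exists (IdealAlg vlimI).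
have [||x vx] := limI (fun j => ideal_val j.1).
- by move=> j; exact: (valP (j.1 : ideal_alg I)).
- by move=> j k; rewrite /conv_norm lerDl.
have [||y vy] := limI (fun j => ideal_val j.2).
- by move=> j; exact: (valP (j.2 : ideal_alg I)).
- by move=> j k; rewrite /conv_norm lerDr.
pose j : J := (x, y).
(* Triangle inequality through some [k] near both: 1 for the distance from [b] to [k], and [C] times
   2 for the two coordinates of [j - k]. *)
have close e : 0 < e -> n (b - conv_sqr_inc j) <= (1 + C * 2) * e.
  move=> e0.
  have Fe : F (S e) by exists e.
  have Fx : \forall k \near F, `|val x - ideal_val k.1| < e.
    exact: cvgr_dist_lt.
  have Fy : \forall k \near F, `|val y - ideal_val k.2| < e.
    exact: cvgr_dist_lt.
  have [k [[kS kx] ky]] := filter_ex (filterI (filterI Fe Fx) Fy).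
  rewrite -(subrK (conv_sqr_inc k) b) -addrA.
  apply: le_trans (algebra_normD Nn _ _) _.
  rewrite mulrDl mul1r lerD ?(ltW kS)// -(algebra_normN _ Nn) opprB.
  apply: le_trans (Cle (j - k)) _; rewrite -mulrA ler_pM2l//.
  by rewrite mulr_natl mulr2n lerD// ltW.
suff -> : b = conv_sqr_inc j by exact: conv_quot_inc.
apply: contrapT => bj.
have d0 : 0 < n (b - conv_sqr_inc j).
  by apply: algebra_norm_gt0 => // /subr0_eq.
have M0 : 0 < 1 + C * 2 by rewrite addr_gt0// mulr_gt0.
(* With this value [close] bounds a positive number by its half. *)
have := close (n (b - conv_sqr_inc j) / (1 + C * 2) / 2).
rewrite !divr_gt0// => /(_ isT).
rewrite mulrA [_ * (_ / _)]mulrC divfK ?gt_eqF//.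
by rewrite lt_geF// ltr_pdivrMr// ltr_pMr// ltr1n.
Qed.
End ConvolutionNorms.

Theorem theorem2p10 (R : realType) (A : banachAlgType R[i]) (I : nuIdeal A)
    (I_closed : closed [set a : A | a \in I]) :
  is_singleton (norm_classes (quot_alg I)) ->
  is_singleton (norm_classes (conv_sqr (ideal_alg I))) ->
  is_singleton (norm_classes (conv_alg I)).
Proof.
move=> Q1 J1.
have Ns := conv_norm_algebra_norm I.
apply: (is_singleton_norm_classes Ns) => n Nn.
have Np := algebra_norm_add Ns Nn.
have le := extension_le (@conv_sqr_inc_hom R A I) (@conv_sqr_inc_inj R A I)
  (@conv_quot_hom R A I) (@conv_quot_surj R A I) (@conv_quot_eq R A I)
  J1 Q1 _ Np.
have [|C C0 pC] := le _ Ns _ (conv_quot_ker_closed I_closed J1 Ns).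
  by move=> b; rewrite lerDl algebra_norm_ge0.
have [|D D0 pD] := le _ Nn _ (conv_quot_ker_closed I_closed J1 Nn).
  by move=> b; rewrite lerDr algebra_norm_ge0.
(* Each of the two norms lies below their sum, which is dominated by the other one. *)
apply/seteqP; split.
- apply: (le_norm_open D0) => b; apply: le_trans (pD b).
  by rewrite lerDl algebra_norm_ge0.
- apply: (le_norm_open C0) => b; apply: le_trans (pC b).
  by rewrite lerDr algebra_norm_ge0.
Qed.
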